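(* Let $\overline{\mathbb A}_0\subseteq\overline{\mathbb A}$ be finite and let $L$ be a bar language (bar word language, bar $\omega$-language, or bar tree language over a finite signature $\Sigma$) accepted by some bar automaton $\mathcal A$ of the corresponding type over $\overline{\mathbb A}_0$, i.e. $L=L_\alpha(\mathcal A)$. Then the restriction $L\restriction\overline{\mathbb A}_0$ is a regular language (respectively: a regular word language over $\overline{\mathbb A}_0$, a regular $\omega$-language over $\overline{\mathbb A}_0$, a regular tree language over the signature $\overline{\mathbb A}_0\times\Sigma$).
   Context: $\mathbb A$ is a fixed countably infinite set of names; $\overline{\mathbb A}=\mathbb A\cup\{\vert a : a\in\mathbb A\}$, where $a$ is a plain name and $\vert a$ a bar name. Finite permutations $\pi$ of $\mathbb A$ act by $\pi\cdot a=\pi(a)$, $\pi\cdot\vert a=\vert\pi(a)$, letterwise on words and nodewise on trees. $(a\ c)$ is the transposition of $a,c$. For objects $x,y$ (finite words over $\overline{\mathbb A}$, or bar trees) write $\langle a\rangle x=\langle b\rangle y$ iff $(a\ c)\cdot x=(b\ c)\cdot y$ for some (equivalently every) name $c\notin\{a,b\}$ that does not occur (plain or barred) in $x$ or $y$. Finite bar strings are elements of $\overline{\mathbb A}^*$; $\equiv_\alpha$ on them is the equivalence relation generated by $w\vert a\,v\equiv_\alpha w\vert b\,u$ whenever $\langle a\rangle v=\langle b\rangle u$. Infinite bar strings are elements of $\overline{\mathbb A}^\omega$; $v\equiv_\alpha w$ iff for every $n$ the length-$n$ prefixes are $\alpha$-equivalent. For a finite signature $\Sigma$, bar trees are finite trees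 over the signature with one $n$-ary symbol $\alpha.f$ for all $\alpha\in\overline{\mathbb A}$ and $n$-ary $f\in\Sigma$; $\equiv_\alpha$ is the least congruence with $\vert a.f(t_1,\dots,t_n)\equiv_\alpha\vert b.f(t_1',\dots,t_n')$ whenever $\langle a\rangle t_i=\langle b\rangle t_i'$ for all $i$. A bar word/$\omega$-/tree language is a set of finite bar strings/infinite bar strings/bar trees closed under $\equiv_\alpha$. $L\restriction\overline{\mathbb A}_0$ is the set of elements of $L$ using only letters from $\overline{\mathbb A}_0$. A bar automaton over a finite alphabet $\overline{\mathbb A}_0\subseteq\overline{\mathbb A}$ is an ordinary DFA/NFA, Büchi automaton, or bottom-up (deterministic or non-deterministic) finite tree automaton over $\overline{\mathbb A}_0$ (in the tree case over the signature $\overline{\mathbb A}_0\times\Sigma$). $L(\mathcal A)$ is its usual accepted (literal) language and $L_\alpha(\mathcal A)$, the bar language accepted by $\mathcal A$, is the closure of $L(\mathcal A)$ under $\equiv_\alpha$. Regular languages are those accepted by ordinary finite automata, Büchi automata, and finite tree automata, respectively. *)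

(* Defs.v *)
From HB Require Import structures.
From Stdlib Require Import Relation_Operators.
From mathcomp Require Import all_boot finmap.
From mathcomp Require Import boolp classical_sets cardinality.

Set Implicit Arguments.
Unset Strict Implicit.
Unset Printing Implicit Defensive.

Local Open Scope classical_set_scope.

Inductive letter (A : Type) := Plain of A | Bar of A.

Section LetterCountable.
Variable A : countType.

Definition sum_of_letter (x : letter A) : A + A :=
  match x with Plain a => inl a | Bar a => inr a end.

Definition letter_of_sum (s : A + A) : letter A :=
  match s with inl a => Plain a | inr a => Bar a end.

Lemma sum_of_letterK : cancel sum_of_letter letter_of_sum.
Proof. by case. Qed.

HB.instance Definition _ :=
  Countable.copy (letter A) (can_type sum_of_letterK).

End LetterCountable.

Section Names.
Variable A : countType.

Definition name_of (x : letter A) : A :=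
  match x with Plain a => a | Bar a => a end.

Definition swap (a c b : A) : A :=
  if b == a then c else if b == c then a else b.

Definition swap_letter (a c : A) (x : letter A) : letter A :=
  match x with Plain b => Plain (swap a c b) | Bar b => Bar (swap a c b) end.

(* [abs_eq act fresh a x b y] is the equation <a>x = <b>y, for objects with
   transposition action [act] and freshness relation [fresh]. *)
Definition abs_eq (T : Type) (act : A -> A -> T -> T) (fresh : A -> T -> Prop)
    (a : A) (x : T) (b : A) (y : T) : Prop :=
  exists c, [/\ c != a, c != b, fresh c x, fresh c y & act a c x = act b c y].

End Names.

Definition closure_under (T : Type) (R : T -> T -> Prop) (L : set T) : set T :=
  [set y | exists2 x, L x & R x y].

Definition closed_under (T : Type) (R : T -> T -> Prop) (L : set T) : Prop :=
  forall x y, R x y -> L x -> L y.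

(* Both finite automata and Buchi automata; the deterministic ones are those
   whose initial and successor sets are singletons. *)
Record nfa (S : finType) := Nfa {
  nfa_state : finType;
  nfa_init : {set nfa_state};
  nfa_final : {set nfa_state};
  nfa_trans : nfa_state -> S -> {set nfa_state} }.

Fixpoint nfa_accept_from (S : finType) (N : nfa S) (q : nfa_state N)
    (w : seq S) : Prop :=
  if w is x :: w' then
    exists2 q', q' \in nfa_trans q x & nfa_accept_from q' w'
  else q \in nfa_final N.

Definition nfa_lang (S : finType) (N : nfa S) : set (seq S) :=
  [set w | exists2 q, q \in nfa_init N & nfa_accept_from q w].

Definition buchi_lang (S : finType) (N : nfa S) : set (nat -> S) :=
  [set w | exists rho : nat -> nfa_state N,
    [/\ rho 0 \in nfa_init N,
        forall i, rho i.+1 \in nfa_trans (rho i) (w i)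
      & forall n, exists2 m, n <= m & rho m \in nfa_final N]].

Inductive tree (X : Type) (ar : X -> nat) :=
  Node x of {ffun 'I_(ar x) -> tree ar}.

(* Bottom-up tree automata; the deterministic ones are those whose transition
   sets are singletons. *)
Record nfta (X : finType) (ar : X -> nat) := Nfta {
  nfta_state : finType;
  nfta_final : {set nfta_state};
  nfta_trans : forall x, {ffun 'I_(ar x) -> nfta_state} -> {set nfta_state} }.

Fixpoint nfta_reach (X : finType) (ar : X -> nat) (N : nfta ar) (t : tree ar)
    (q : nfta_state N) : Prop :=
  let: Node x ts := t in
  exists2 qs : {ffun 'I_(ar x) -> nfta_state N},
    forall i, nfta_reach (ts i) (qs i) & q \in nfta_trans qs.

Definition nfta_lang (X : finType) (ar : X -> nat) (N : nfta ar) :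
    set (tree ar) :=
  [set t | exists2 q, q \in nfta_final N & nfta_reach t q].

(* The signature X * Sig, where (x, f) has the arity of f. *)
Definition label_ar (X Sig : Type) (ar : Sig -> nat) (p : X * Sig) : nat :=
  ar p.2.

Definition ltree (X Sig : Type) (ar : Sig -> nat) : Type :=
  tree (@label_ar X Sig ar).

Section LabelledTrees.
Variables (Sig : Type) (ar : Sig -> nat).

Definition LNode (X : Type) (x : X) (f : Sig)
    (ts : {ffun 'I_(ar f) -> ltree X ar}) : ltree X ar :=
  @Node (X * Sig) (@label_ar X Sig ar) (x, f) ts.

Fixpoint ltree_map (X Y : Type) (h : X -> Y) (t : ltree X ar) : ltree Y ar :=
  let: Node p ts := t in LNode (h p.1) [ffun i => ltree_map h (ts i)].

Fixpoint ltree_all (X : Type) (P : X -> Prop) (t : ltree X ar) : Prop :=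
  let: Node p ts := t in P p.1 /\ forall i, ltree_all P (ts i).

End LabelledTrees.

Section BarWords.
Variable A : countType.

Definition word_abs_eq : A -> seq (letter A) -> A -> seq (letter A) -> Prop :=
  abs_eq (fun a c => map (swap_letter a c))
         (fun c w => forall x, x \in w -> name_of x != c).

Inductive word_alpha_step : seq (letter A) -> seq (letter A) -> Prop :=
  WordAlphaStep w a v b u : word_abs_eq a v b u ->
    word_alpha_step (w ++ Bar a :: v) (w ++ Bar b :: u).

Definition word_alpha : seq (letter A) -> seq (letter A) -> Prop :=
  clos_refl_sym_trans _ word_alpha_step.

Definition omega_alpha (v w : nat -> letter A) : Prop :=
  forall n, word_alpha (mkseq v n) (mkseq w n).

Variable A0 : {fset letter A}.

Definition word_literal (N : nfa A0) : set (seq (letter A)) :=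
  [set map val w | w in nfa_lang N].

Definition omega_literal (N : nfa A0) : set (nat -> letter A) :=
  [set val \o w | w in buchi_lang N].

Definition word_restrict (L : set (seq (letter A))) : set (seq (letter A)) :=
  [set w | L w /\ {subset w <= A0}].

Definition omega_restrict (L : set (nat -> letter A)) : set (nat -> letter A) :=
  [set w | L w /\ forall i, w i \in A0].

Definition word_regular (L : set (seq (letter A))) : Prop :=
  exists N : nfa A0, L = word_literal N.

Definition omega_regular (L : set (nat -> letter A)) : Prop :=
  exists N : nfa A0, L = omega_literal N.

End BarWords.

Section BarTrees.
Variables (A : countType) (Sig : finType) (ar : Sig -> nat).

Definition tree_abs_eq :
    A -> ltree (letter A) ar -> A -> ltree (letter A) ar -> Prop :=
  abs_eq (fun a c => ltree_map (swap_letter a c))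
         (fun c => ltree_all (fun x => name_of x != c)).

Inductive tree_alpha : ltree (letter A) ar -> ltree (letter A) ar -> Prop :=
| TreeAlphaRefl t : tree_alpha t t
| TreeAlphaSym t u : tree_alpha t u -> tree_alpha u t
| TreeAlphaTrans t u v : tree_alpha t u -> tree_alpha u v -> tree_alpha t v
| TreeAlphaCongr x f (ts us : {ffun 'I_(ar f) -> ltree (letter A) ar}) :
    (forall i, tree_alpha (ts i) (us i)) ->
    tree_alpha (LNode x ts) (LNode x us)
| TreeAlphaBar a b f (ts us : {ffun 'I_(ar f) -> ltree (letter A) ar}) :
    (forall i, tree_abs_eq a (ts i) b (us i)) ->
    tree_alpha (LNode (Bar a) ts) (LNode (Bar b) us).

Variable A0 : {fset letter A}.

Definition tree_literal (N : nfta (@label_ar A0 Sig ar)) :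
    set (ltree (letter A) ar) :=
  [set ltree_map val t | t in nfta_lang N].

Definition tree_restrict (L : set (ltree (letter A) ar)) :
    set (ltree (letter A) ar) :=
  [set t | L t /\ ltree_all (fun x => x \in A0) t].

Definition tree_regular (L : set (ltree (letter A) ar)) : Prop :=
  exists N : nfta (@label_ar A0 Sig ar), L = tree_literal N.

End BarTrees.

(* Main.v *)
Require Import Defs.
From Stdlib Require Import Relation_Operators.
From mathcomp Require Import all_boot finmap.
From mathcomp Require Import boolp classical_sets cardinality.

Set Implicit Arguments.
Unset Strict Implicit.
Unset Printing Implicit Defensive.

(* Two words or trees are alpha-equivalent iff a synchronous scan succeeds that
   maintains the relation [R] "the name a on the left and the name b on the
   right refer to the same binder, or are both free and equal". Over the finite
   alphabet A0 only the finite restriction of [R] to names of A0 matters, so an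
   automaton over A0 can guess a literally accepted object and check on the fly,
   with [R] as an additional state component, that it is alpha-equivalent to its
   input. The acceptance condition only inspects the guessed run; this is why
   the same product serves finite words and the Buechi case. *)

(** * Relations between names, and how binders update them *)

Section NameRelations.
Variable A : countType.
Implicit Types (R S : A -> A -> Prop) (x y z : letter A) (P : letter A -> Prop).

(** A binder may be renamed freely, so the names of two bar letters are not compared. *)
Definition letter_match R x y : Prop :=
  match x, y with
  | Plain a, Plain b => R a b
  | Bar _, Bar _ => True
  | _, _ => False
  end.

(** The two new binders shadow all earlier ones of the same name, so every older pair with [a] on
    the left or [b] on the right is dropped. Letters of different kinds get a default value, as
    [letter_match] already fails on them. *)
Definition rebind R x y : A -> A -> Prop :=
  match x, y with
  | Bar a, Bar b => fun a' b' =>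
      (a' = a /\ b' = b) \/ [/\ a' <> a, b' <> b & R a' b']
  | _, _ => R
  end.

Definition sub_on P R S : Prop :=
  forall x y, P x -> P y -> R (name_of x) (name_of y) -> S (name_of x) (name_of y).

Definition rcomp R S : A -> A -> Prop := fun a c => exists2 b, R a b & S b c.

Definition rinv R : A -> A -> Prop := fun a b => R b a.

(** The name [c] is left out of the domain because the graph is used on objects in which [c] is
    fresh; the two lemmas on its composites below rely on this. *)
Definition swap_graph (a c : A) : A -> A -> Prop :=
  fun b b' => b != c /\ b' = swap a c b.

Lemma sub_onT R S : (forall a b, R a b -> S a b) -> sub_on (fun=> True) R S.
Proof. by move=> RS x y _ _; apply: RS. Qed.

Lemma letter_match_sub P R S x y : sub_on P R S -> P x -> P y ->
  letter_match R x y -> letter_match S x y.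
Proof. by move=> RS; case: x y => a [] b //= Pa Pb; apply: (RS (Plain a) (Plain b)). Qed.

Lemma rebind_sub P R S x y : sub_on P R S -> sub_on P (rebind R x y) (rebind S x y).
Proof.
move=> RS; case: x y => a [] b //= x y Px Py [?|[? ? ?]]; first by left.
by right; split=> //; apply: RS.
Qed.

Lemma letter_match_inv R x y : letter_match R x y -> letter_match (rinv R) y x.
Proof. by case: x y => a []. Qed.

Lemma rebind_inv R x y a b : rinv (rebind R x y) a b -> rebind (rinv R) y x a b.
Proof. by case: x y => c [] d //= [[-> ->]|[? ? ?]]; [left | right]. Qed.

Lemma letter_match_comp R S x y z :
  letter_match R x y -> letter_match S y z -> letter_match (rcomp R S) x z.
Proof. by case: x y z => a [] b [] c //= Rab Sbc; exists b. Qed.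

(** The matches force all three letters to be of one kind. For bar letters, the middle name either
    is the middle binder for both relations or differs from it for both, so the two clauses of
    [rebind] never mix. *)
Lemma rebind_comp R S x y z a c : letter_match R x y -> letter_match S y z ->
  rcomp (rebind R x y) (rebind S y z) a c -> rebind (rcomp R S) x z a c.
Proof.
case: x y z => x [] y [] z //= _ _ [b [[-> ->]|[ax bx Rab]] [[e ->]|[by' cz Sbc]]] //.
  by left.
by right; split=> //; exists b.
Qed.

Lemma letter_match_refl R x : (forall a, R a a) -> letter_match R x x.
Proof. by case: x => a //=; apply. Qed.

Lemma rebind_refl R x a : (forall a, R a a) -> rebind R x x a a.
Proof.
by move=> RR; case: x => b //=; case: (pselect (a = b)) => [->|]; [left | right].
Qed.

Lemma swap_inj (a c : A) : injective (swap a c).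
Proof.
apply: inv_inj => b; rewrite /swap.
case: (eqVneq b a) => [->|ba]; first by rewrite eqxx; case: (eqVneq c a).
by case: (eqVneq b c) => [->|bc]; rewrite ?eqxx // (negPf ba) (negPf bc).
Qed.

Lemma letter_match_swap R a c x : name_of x != c ->
  (forall b, b != c -> R b (swap a c b)) -> letter_match R x (swap_letter a c x).
Proof. by case: x => b //= bc; apply. Qed.

Lemma rebind_swap R a c x b :
  (forall b, b != c -> R b (swap a c b)) -> b != c ->
  rebind R x (swap_letter a c x) b (swap a c b).
Proof.
move=> RR bc; case: x => d /=; first exact: RR.
case: (pselect (b = d)) => [->|bd]; [by left | right; split=> //; last exact: RR].
by move=> /swap_inj.
Qed.

(** This translates the equation of abstractions: renaming [a] to [c] and then [c] back to [b] pairs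
    [a] with [b] and fixes every other name. *)
Lemma swap_graph_abs a b c (x y : A) :
  rcomp (swap_graph a c) (rinv (swap_graph b c)) x y ->
  rebind eq (Bar a) (Bar b) x y.
Proof.
case=> z [xc ->] [yc]; rewrite /swap (negPf xc) (negPf yc) /=.
case: (eqVneq x a) => [->|/eqP xa]; case: (eqVneq y b) => [->|/eqP yb] e.
- by left.
- by rewrite e eqxx in yc.
- by rewrite e eqxx in xc.
- by right.
Qed.

(** Conversely, once both binders are renamed to the same fresh [c], the pair of [a] and [b] becomes
    the pair of [c] with itself, and only equality is left. *)
Lemma swap_graph_unabs a b c (x y : A) :
  rcomp (rinv (swap_graph a c))
        (rcomp (rebind eq (Bar a) (Bar b)) (swap_graph b c)) x y -> x = y.
Proof.
case=> z [zc ->] [z' /= [[-> ->]|[/eqP za /eqP z'b zz']] [z'c ->]]; rewrite /swap.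
  by rewrite !eqxx.
by move: z'b z'c; rewrite -zz' (negPf za) (negPf zc) => /negPf ->.
Qed.

Lemma swap_letter_comp a c d x : name_of x != c -> name_of x != d ->
  swap_letter c d (swap_letter a c x) = swap_letter a d x.
Proof.
suff swapE b : b != c -> b != d -> swap c d (swap a c b) = swap a d b.
  by case: x => b /= bc bd; rewrite swapE.
rewrite /swap => bc bd; rewrite (negPf bc) (negPf bd).
by case: (b == a); rewrite ?eqxx // (negPf bc) (negPf bd).
Qed.

Lemma exists_notin (s : seq A) : infinite_set (@setT A) -> exists c, c \notin s.
Proof.
move=> infA; apply: contrapT => /forallNP sA; apply: infA.
apply: (@sub_finite_set _ _ [set` s]%classic); last exact: finite_seq.
by move=> a _ /=; apply: contrapT => /negP /sA.
Qed.

End NameRelations.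

(** * Alpha-equivalence of finite and infinite words as a synchronous scan *)

Section WordScan.
Variable A : countType.
Implicit Types (R S : A -> A -> Prop) (v w : seq (letter A)).

Fixpoint word_match R v w : Prop :=
  match v, w with
  | [::], [::] => True
  | x :: v', y :: w' => letter_match R x y /\ word_match (rebind R x y) v' w'
  | _, _ => False
  end.

Lemma word_match_sub P R S v w : sub_on P R S ->
  (forall x, x \in v -> P x) -> (forall x, x \in w -> P x) ->
  word_match R v w -> word_match S v w.
Proof.
elim: v w R S => [|x v IHv] [|y w] R S RS //= Pv Pw [xy vw]; split.
  by apply: letter_match_sub RS _ _ xy; [apply: Pv | apply: Pw]; rewrite mem_head.
apply: IHv (rebind_sub RS) _ _ vw => z zv; first by apply: Pv; rewrite inE zv orbT.
by apply: Pw; rewrite inE zv orbT.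
Qed.

Lemma word_match_mono R S v w : (forall a b, R a b -> S a b) ->
  word_match R v w -> word_match S v w.
Proof. by move=> /sub_onT RS; apply: word_match_sub RS _ _. Qed.

Lemma word_match_inv R v w : word_match R v w -> word_match (rinv R) w v.
Proof.
elim: v w R => [|x v IHv] [|y w] R //= [/letter_match_inv xy /IHv vw]; split=> //.
by apply: word_match_mono vw; apply: rebind_inv.
Qed.

Lemma word_match_comp R S u v w :
  word_match R u v -> word_match S v w -> word_match (rcomp R S) u w.
Proof.
elim: u v w R S => [|x u IHu] [|y v] [|z w] R S //= [xy uv] [yz vw]; split.
  exact: letter_match_comp xy yz.
by apply: word_match_mono (IHu _ _ _ _ uv vw) => a c; apply: rebind_comp.
Qed.

(** Reflexivity of the relation, unlike being literally [eq], is an invariant that survives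
    rebinding along the common prefix. *)
Lemma word_match_cat R w u v : (forall a, R a a) ->
  word_match eq u v -> word_match R (w ++ u) (w ++ v).
Proof.
elim: w R => [|x w IHw] R RR uv /=.
  by apply: word_match_mono uv => a b ->.
split; first exact: letter_match_refl.
by apply: IHw => // a; apply: rebind_refl.
Qed.

Lemma word_match_swap R a c v : (forall b, b != c -> R b (swap a c b)) ->
  (forall x, x \in v -> name_of x != c) -> word_match R v (map (swap_letter a c) v).
Proof.
elim: v R => [|x v IHv] R RR //= cv; split.
  by apply: letter_match_swap => //; apply: cv; rewrite mem_head.
apply: IHv => [b bc|y yv]; first exact: rebind_swap.
by apply: cv; rewrite inE yv orbT.
Qed.

(** Both words match the common word obtained by renaming to [c]; composing one match with the
    inverse of the other eliminates that word. *)
Lemma word_match_abs a v b u :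
  word_abs_eq a v b u -> word_match (rebind eq (Bar a) (Bar b)) v u.
Proof.
case=> c [ca cb cv cu e].
have vz : word_match (swap_graph a c) v (map (swap_letter a c) v).
  exact: word_match_swap.
have uz : word_match (swap_graph b c) u (map (swap_letter a c) v).
  by rewrite e; apply: word_match_swap.
apply: word_match_mono (word_match_comp vz (word_match_inv uz)) => x y.
exact: swap_graph_abs.
Qed.

Lemma word_alpha_match v w : word_alpha v w -> word_match eq v w.
Proof.
elim=> {v w} [_ _ [w a v b u vu]|v|v w _ /word_match_inv vw|u v w _ uv _ vw].
- apply: word_match_cat => //; split=> //; exact: word_match_abs.
- by rewrite -[v]cats0; apply: word_match_cat.
- exact: word_match_mono vw.
- by apply: word_match_mono (word_match_comp uv vw) => a c [b -> ->].
Qed.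

Lemma word_alpha_cons x v w : word_alpha v w -> word_alpha (x :: v) (x :: w).
Proof.
elim=> {v w} [_ _ [w a v b u vu]|v|v w _ vw|u v w _ uv _ vw].
- by apply: rst_step; rewrite -!cat_cons; constructor.
- exact: rst_refl.
- exact: rst_sym.
- exact: rst_trans uv vw.
Qed.

Hypothesis A_infinite : infinite_set (@setT A).

Lemma word_alpha_rename a c v : c != a -> (forall x, x \in v -> name_of x != c) ->
  word_alpha (Bar a :: v) (Bar c :: map (swap_letter a c) v).
Proof.
move=> ca cv; set v' := map _ _.
(* The name [c] cannot witness the equation of abstractions, being itself one of the two binders;
   hence a second fresh name. *)
have [d] := exists_notin [:: a, c & map (@name_of A) (v ++ v')] A_infinite.
rewrite !inE map_cat mem_cat !negb_or => /and4P[da dc dv dv'].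
have fresh (u : seq (letter A)) : d \notin map (@name_of A) u ->
    forall x, x \in u -> name_of x != d.
  by move=> du x xu; apply: contraNneq du => <-; apply: map_f.
apply: rst_step; apply: (@WordAlphaStep _ [::]); exists d; split=> //; try exact: fresh.
rewrite /v' -map_comp; apply/eq_in_map => x xv /=.
by rewrite swap_letter_comp //; [apply: cv | apply: fresh xv].
Qed.

(** Induction on length, not on structure: under a bar letter both tails are first renamed to a
    common fresh binder, and the induction hypothesis is applied to the renamed tails. *)
Lemma word_match_alpha v w : word_match eq v w -> word_alpha v w.
Proof.
have [n] := ubnP (size v); elim: n v w => // n IHn [|[a|a] v] [|[b|b] w] //=;
  rewrite ?ltnS => vn.
- by move=> _; apply: rst_refl.
- by case=> -> vw; apply/word_alpha_cons/IHn.
- by case.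
- by case.
case=> _ vw.
have [c] := exists_notin [:: a, b & map (@name_of A) (v ++ w)] A_infinite.
rewrite !inE map_cat mem_cat !negb_or => /and4P[ca cb cv cw].
have fresh (u : seq (letter A)) : c \notin map (@name_of A) u ->
    forall x, x \in u -> name_of x != c.
  by move=> du x xu; apply: contraNneq du => <-; apply: map_f.
move/fresh: cv => cv; move/fresh: cw => cw.
apply: rst_trans (word_alpha_rename ca cv) _.
apply: (rst_trans _ _ _ _ _ _ (rst_sym _ _ _ _ (word_alpha_rename cb cw))).
apply/word_alpha_cons/IHn; first by rewrite size_map.
have vv : word_match (swap_graph a c) v (map (swap_letter a c) v).
  exact: word_match_swap.
have ww : word_match (swap_graph b c) w (map (swap_letter b c) w).
  exact: word_match_swap.
(* From the renamed [v] back to [v], across to [w], and on to the renamed [w]. *)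
apply: word_match_mono (word_match_comp (word_match_inv vv) (word_match_comp vw ww)).
exact: swap_graph_unabs.
Qed.

Lemma word_alphaP v w : word_alpha v w <-> word_match eq v w.
Proof. by split; [apply: word_alpha_match | apply: word_match_alpha]. Qed.

Fixpoint scan R (v w : nat -> letter A) (n : nat) : A -> A -> Prop :=
  if n is m.+1 then rebind (scan R v w m) (v m) (w m) else R.

(** [scan] grows at the end, like a run, whereas [word_match] consumes letters from the front; this
    reconciles the two. *)
Lemma scanS R (v w : nat -> letter A) n :
  scan R v w n.+1 = scan (rebind R (v 0) (w 0)) (v \o succn) (w \o succn) n.
Proof. by elim: n => //= n ->. Qed.

Lemma word_match_mkseq R (v w : nat -> letter A) n :
  word_match R (mkseq v n) (mkseq w n) <->
  (forall i, i < n -> letter_match (scan R v w i) (v i) (w i)).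
Proof.
have mkseqS (u : nat -> letter A) m : mkseq u m.+1 = u 0 :: mkseq (u \o succn) m.
  by rewrite /mkseq /= (iotaDl 1 0) -map_comp.
elim: n v w R => [|n IHn] v w R; first by split.
rewrite !mkseqS /=; split=> [[xy /IHn vw] [|i]|vw] //; last first.
  by split; [apply: (vw 0) | apply/IHn => i ?; rewrite -scanS; apply: (vw i.+1)].
by rewrite ltnS => /vw; rewrite -scanS.
Qed.

(** The relation at position [i] depends only on earlier letters, so the conditions on all prefixes
    amount to one condition per position. *)
Lemma omega_alphaP (v w : nat -> letter A) :
  omega_alpha v w <-> forall i, letter_match (scan eq v w i) (v i) (w i).
Proof.
split=> [vw i|vw n]; last by apply/word_alphaP/word_match_mkseq => i _.
by have /word_alphaP/word_match_mkseq := vw i.+1; apply.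
Qed.

End WordScan.

(** * Cutting the relation down to the finite alphabet *)

Section FiniteRestriction.
Variables (A : countType) (A0 : {fset letter A}).
Implicit Types (R : A -> A -> Prop) (S : {set A0 * A0}).

(* A relation on the names of A0 is stored as a relation on letters of A0. *)
Definition restrict_rel R : {set A0 * A0} :=
  [set p | `[< R (name_of (val p.1)) (name_of (val p.2)) >]].

Definition extend_rel S : A -> A -> Prop :=
  fun a b => exists2 p, p \in S & name_of (val p.1) = a /\ name_of (val p.2) = b.

Lemma extend_restrict R x y : x \in A0 -> y \in A0 ->
  extend_rel (restrict_rel R) (name_of x) (name_of y) <-> R (name_of x) (name_of y).
Proof.
move=> xA yA; split=> [[p]|Rxy]; first by rewrite inE => /asboolP ? [<- <-].
by exists ([` xA], [` yA])%fset => //; rewrite inE; apply/asboolP.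
Qed.

Lemma extend_restrict_sub R :
  sub_on (fun x => x \in A0) (extend_rel (restrict_rel R)) R.
Proof. by move=> x y xA yA /extend_restrict; apply. Qed.

Lemma sub_extend_restrict R :
  sub_on (fun x => x \in A0) R (extend_rel (restrict_rel R)).
Proof. by move=> x y xA yA /extend_restrict; apply. Qed.

Lemma letter_match_restrict R (x y : A0) :
  letter_match (extend_rel (restrict_rel R)) (val x) (val y) <->
  letter_match R (val x) (val y).
Proof.
by split; apply: (@letter_match_sub _ (fun z => z \in A0)); do ?exact: valP;
  [apply: extend_restrict_sub | apply: sub_extend_restrict].
Qed.

Definition rebind_restrict S (x y : A0) : {set A0 * A0} :=
  restrict_rel (rebind (extend_rel S) (val x) (val y)).

(** For names of [A0], being related after rebinding depends only on the two letters and on [R] at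
    names of [A0]. A finite state component therefore tracks the relation exactly. *)
Lemma rebind_restrictE R (x y : A0) :
  rebind_restrict (restrict_rel R) x y = restrict_rel (rebind R (val x) (val y)).
Proof.
apply/setP => p; rewrite !inE; apply: asbool_equiv_eq; split;
  apply: (@rebind_sub _ (fun z => z \in A0)); do ?exact: valP;
  [apply: extend_restrict_sub | apply: sub_extend_restrict].
Qed.

Lemma word_match_restrict R (v w : seq A0) :
  word_match (extend_rel (restrict_rel R)) (map val v) (map val w) <->
  word_match R (map val v) (map val w).
Proof.
have inA (u : seq A0) x : x \in map val u -> x \in A0 by case/mapP=> y _ ->; apply: valP.
split; apply: word_match_sub (inA v) (inA w).
  exact: extend_restrict_sub.
exact: sub_extend_restrict.
Qed.

Lemma subset_map_val (w : seq (letter A)) :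
  {subset w <= A0} -> exists w0 : seq A0, w = map val w0.
Proof.
elim: w => [|x w IHw] wA; first by exists [::].
have [|w0 ->] := IHw; first by move=> y yw; apply: wA; rewrite inE yw orbT.
by exists ([` wA x (mem_head _ _)]%fset :: w0).
Qed.

End FiniteRestriction.

(** * The product automaton on finite and infinite words *)

Section WordAutomata.
Variables (A : countType) (A0 : {fset letter A}) (N : nfa A0).
Hypothesis A_infinite : infinite_set (@setT A).

(** In the stored pairs, left components belong to the guessed word and right components to the
    input. *)
Definition alpha_nfa : nfa A0 :=
  @Nfa A0 (nfa_state N * {set A0 * A0})%type
    [set p | (p.1 \in nfa_init N) && (p.2 == restrict_rel A0 eq)]
    [set p | p.1 \in nfa_final N]
    (fun p y => [set p' | [exists x : A0,
       [&& `[< letter_match (extend_rel p.2) (val x) (val y) >],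
           p'.1 \in nfa_trans p.1 x & p'.2 == rebind_restrict p.2 x y]]]).

Lemma alpha_nfa_transP q S y q' S' :
  reflect (exists x : A0, [/\ letter_match (extend_rel S) (val x) (val y),
     q' \in nfa_trans q x & S' = rebind_restrict S x y])
  ((q', S') \in @nfa_trans _ alpha_nfa (q, S) y).
Proof.
rewrite inE; apply: (iffP existsP) => -[x].
  by case/and3P=> /asboolP ? ? /eqP ?; exists x.
by case=> ? ? ?; exists x; apply/and3P; split=> //; [apply/asboolP | apply/eqP].
Qed.

(** Stated for arbitrary [S], since each letter replaces the relation. *)
Lemma alpha_nfa_accept_from q (S : {set A0 * A0}) (w : seq A0) :
  @nfa_accept_from _ alpha_nfa (q, S) w <->
  exists2 v : seq A0, nfa_accept_from q v &
    word_match (extend_rel S) (map val v) (map val w).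
Proof.
elim: w q S => [|y w IHw] q S.
  rewrite /= inE /=; split=> [qF|[[|x v] //=]]; by exists [::].
split=> [[[q' S'] /alpha_nfa_transP[x [xy qq' ->]] /IHw[v vacc vw]]|].
  by exists (x :: v) => /=; [exists q' | split=> //; apply/word_match_restrict].
case=> -[|x v] //= [q' qq' vacc] [xy vw]; exists (q', rebind_restrict S x y).
  by apply/alpha_nfa_transP; exists x.
by apply/IHw; exists v => //; apply/word_match_restrict.
Qed.

(** Both the literal word of [N] and the restricted input lie over [A0], which is why the finite
    relation suffices to compare them. *)
Lemma word_restrict_regular :
  word_regular A0 (word_restrict A0
    (closure_under (@word_alpha A) (word_literal N))).
Proof.
exists alpha_nfa; apply/seteqP; split=> w.
  case=> -[_ [v [q qI vacc] <-]] /(word_alphaP A_infinite) vw /subset_map_val[w0 we].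
  exists w0 => //; exists (q, restrict_rel A0 eq); first by rewrite inE /= qI eqxx.
  by apply/alpha_nfa_accept_from; exists v => //; apply/word_match_restrict; rewrite -we.
case=> w0 [[q S]]; rewrite inE /= => /andP[qI /eqP ->].
move=> /alpha_nfa_accept_from[v vacc /word_match_restrict vw] <-; split.
  by exists (map val v); [exists v => //; exists q | apply/word_alphaP].
by move=> _ /mapP[x _ ->]; apply: valP.
Qed.

Lemma omega_restrict_regular :
  omega_regular A0 (omega_restrict A0
    (closure_under (@omega_alpha A) (omega_literal N))).
Proof.
exists alpha_nfa; apply/seteqP; split=> w.
  case=> -[_ [v [rho [rho0 rhoS rhoF]] <-]] /(omega_alphaP A_infinite) vw wA.
  pose w0 i : A0 := [` wA i]%fset.
  exists w0; last by apply: funext.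
  (* The run of [N] is paired with the restricted scan relation at each position. *)
  exists (fun i => (rho i, restrict_rel A0 (scan eq (val \o v) w i))); split.
  - by rewrite inE /= rho0 eqxx.
  - move=> i; apply/alpha_nfa_transP; exists (v i); split=> //.
      exact/letter_match_restrict/vw.
    by rewrite rebind_restrictE.
  - by move=> n; have [m nm mF] := rhoF n; exists m => //; rewrite inE.
case=> w0 [rho [rho0 rhoS rhoF]] <-; split; last by move=> i; apply: valP.
(* The letters guessed along the run are assembled by choice into one infinite word. *)
have /choice[v vP] : forall i, exists x : A0,
    [/\ letter_match (extend_rel (rho i).2) (val x) (val (w0 i)),
        (rho i.+1).1 \in nfa_trans (rho i).1 x
      & (rho i.+1).2 = rebind_restrict (rho i).2 x (w0 i)].
  by move=> i; apply/alpha_nfa_transP; have := rhoS i; rewrite -!surjective_pairing.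
(* The initial state and the transitions force the second component of the run. *)
have scanE i : (rho i).2 = restrict_rel A0 (scan eq (val \o v) (val \o w0) i).
  elim: i => [|i IHi]; first by move: rho0; rewrite inE => /andP[_ /eqP].
  by have [_ _ ->] := vP i; rewrite IHi rebind_restrictE.
exists (val \o v).
  exists v => //; exists (fst \o rho); split=> [|i|n].
  - by move: rho0; rewrite inE => /andP[].
  - by have [] := vP i.
  - by have [m nm] := rhoF n; rewrite inE; exists m.
apply/omega_alphaP => // i; have [xy _ _] := vP i.
by apply/letter_match_restrict; rewrite -scanE.
Qed.

End WordAutomata.

(** * Induction and relabelling for labelled trees *)

Section LabelledTreeFacts.
Variables (Sig : finType) (ar : Sig -> nat).

(* The generated principle gives no hypothesis for the subtrees. *)
Lemma ltree_ind X (P : ltree X ar -> Prop) :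
  (forall x f (ts : {ffun 'I_(ar f) -> ltree X ar}),
     (forall i, P (ts i)) -> P (LNode x ts)) ->
  forall t, P t.
Proof. by move=> IH; fix F 1 => -[[x f] ts]; apply: IH => i; apply: F. Qed.

Lemma ltree_all_map X Y (h : X -> Y) (P : Y -> Prop) (t : ltree X ar) :
  (forall x, P (h x)) -> ltree_all P (ltree_map h t).
Proof.
by move=> Ph; elim/ltree_ind: t => x f ts IHt /=; split=> // i; rewrite ffunE.
Qed.

Lemma ltree_map_comp X Y Z (g : Y -> Z) (h : X -> Y) (t : ltree X ar) :
  ltree_map g (ltree_map h t) = ltree_map (g \o h) t.
Proof.
elim/ltree_ind: t => x f ts IHt /=; congr (LNode _ _).
by apply/ffunP => i; rewrite !ffunE.
Qed.

Lemma eq_in_ltree_map X Y (P : X -> Prop) (g h : X -> Y) (t : ltree X ar) :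
  (forall x, P x -> g x = h x) -> ltree_all P t -> ltree_map g t = ltree_map h t.
Proof.
move=> gh; elim/ltree_ind: t => x f ts IHt /= [/gh -> Pts]; congr (LNode _ _).
by apply/ffunP => i; rewrite !ffunE IHt.
Qed.

Lemma ltree_all_val (T : choiceType) (A0 : {fset T}) (t : ltree T ar) :
  ltree_all (fun x => x \in A0) t -> exists t0 : ltree A0 ar, t = ltree_map val t0.
Proof.
elim/ltree_ind: t => x f ts IHt /= [xA tsA].
have [ts0 ts0E] := fin_all_exists (fun i => IHt i (tsA i)).
exists (LNode [` xA]%fset [ffun i => ts0 i]); rewrite /=; congr (LNode _ _).
by apply/ffunP => i; rewrite !ffunE.
Qed.

End LabelledTreeFacts.

(** * Alpha-equivalence of trees as a top-down scan *)

Section TreeScan.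
Variables (A : countType) (Sig : finType) (ar : Sig -> nat).
Implicit Types (R S : A -> A -> Prop) (t u : ltree (letter A) ar).

(** The arity depends on the symbol, so children can be compared only along a proof that the symbols
    agree, by a cast of indices. *)
Fixpoint tree_match R t u : Prop :=
  let: Node p ts := t in
  let: Node q us := u in
  letter_match R p.1 q.1 /\
  exists e : p.2 = q.2, forall i,
    tree_match (rebind R p.1 q.1) (ts i) (us (cast_ord (congr1 ar e) i)).

Lemma tree_match_LNode R x y f (ts us : {ffun 'I_(ar f) -> ltree (letter A) ar}) :
  tree_match R (LNode x ts) (LNode y us) <->
  letter_match R x y /\ forall i, tree_match (rebind R x y) (ts i) (us i).
Proof.
split=> /= -[xy]; last by move=> tsus; split=> //; exists erefl => i; rewrite cast_ord_id.
case=> e tsus; split=> // i; have := tsus i.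
(* [Sig] has decidable equality, so [e] is the reflexivity proof and the cast vanishes. *)
by rewrite (eq_axiomK e) cast_ord_id.
Qed.

Lemma tree_match_LNodel R x f (ts : {ffun 'I_(ar f) -> ltree (letter A) ar}) u :
  tree_match R (LNode x ts) u -> exists y us,
    [/\ u = LNode y us, letter_match R x y
      & forall i, tree_match (rebind R x y) (ts i) (us i)].
Proof.
case: u => -[y g] us xu; have [/= xy [e _]] := xu.
by subst g; exists y, us; have /tree_match_LNode[] := xu.
Qed.

Lemma tree_match_sub P R S t u : sub_on P R S -> ltree_all P t -> ltree_all P u ->
  tree_match R t u -> tree_match S t u.
Proof.
elim/ltree_ind: t u R S => x f ts IHt u R S RS [Px Pts] Pu.
case/tree_match_LNodel=> y [us [uE xy tsus]]; move: Pu; rewrite uE => -[Py Pus].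
apply/tree_match_LNode; split; first exact: letter_match_sub RS _ _ xy.
move=> i; apply: IHt (rebind_sub RS) _ _ (tsus i).
  exact: Pts.
exact: Pus.
Qed.

Lemma tree_match_mono R S t u : (forall a b, R a b -> S a b) ->
  tree_match R t u -> tree_match S t u.
Proof.
have allT t' : ltree_all (fun=> True) t' by elim/ltree_ind: t' => x f ts IHt.
by move=> /sub_onT RS; apply: tree_match_sub RS _ _.
Qed.

Lemma tree_match_inv R t u : tree_match R t u -> tree_match (rinv R) u t.
Proof.
elim/ltree_ind: t u R => x f ts IHt u R.
case/tree_match_LNodel=> y [us [-> xy tsus]].
apply/tree_match_LNode; split=> [|i]; first exact: letter_match_inv.
by apply: tree_match_mono (IHt _ _ _ (tsus i)); apply: rebind_inv.
Qed.

Lemma tree_match_comp R S s t u :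
  tree_match R s t -> tree_match S t u -> tree_match (rcomp R S) s u.
Proof.
elim/ltree_ind: s t u R S => x f ss IHs t u R S.
case/tree_match_LNodel=> y [ts [-> xy ssts]].
case/tree_match_LNodel=> z [us [-> yz tsus]].
apply/tree_match_LNode; split=> [|i]; first exact: letter_match_comp xy yz.
apply: tree_match_mono (IHs _ _ _ _ _ (ssts i) (tsus i)) => a c.
exact: rebind_comp.
Qed.

Lemma tree_match_refl R t : (forall a, R a a) -> tree_match R t t.
Proof.
elim/ltree_ind: t R => x f ts IHt R RR; apply/tree_match_LNode.
split=> [|i]; first exact: letter_match_refl.
by apply: IHt => a; apply: rebind_refl.
Qed.

Lemma tree_match_swap R a c t : (forall b, b != c -> R b (swap a c b)) ->
  ltree_all (fun x => name_of x != c) t ->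
  tree_match R t (ltree_map (swap_letter a c) t).
Proof.
elim/ltree_ind: t R => x f ts IHt R RR [xc ct]; apply/tree_match_LNode.
split=> [|i]; first exact: letter_match_swap.
by rewrite ffunE; apply: IHt (ct i) => b bc; apply: rebind_swap.
Qed.

Lemma tree_match_abs a t b u :
  tree_abs_eq a t b u -> tree_match (rebind eq (Bar a) (Bar b)) t u.
Proof.
case=> c [ca cb ct cu e].
have tz : tree_match (swap_graph a c) t (ltree_map (swap_letter a c) t).
  exact: tree_match_swap.
have uz : tree_match (swap_graph b c) u (ltree_map (swap_letter a c) t).
  by rewrite e; apply: tree_match_swap.
apply: tree_match_mono (tree_match_comp tz (tree_match_inv uz)) => x y.
exact: swap_graph_abs.
Qed.

Lemma tree_alpha_match t u : tree_alpha t u -> tree_match eq t u.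
Proof.
elim=> {t u} [t|t u _ /tree_match_inv tu|s t u _ st _ tu|x f ts us _ tsus|
    a b f ts us tsus].
- exact: tree_match_refl.
- exact: tree_match_mono tu.
- by apply: tree_match_mono (tree_match_comp st tu) => a c [b -> ->].
- apply/tree_match_LNode; split=> [|i]; first exact: letter_match_refl.
  by apply: tree_match_mono (tsus i) => a _ <-; apply: rebind_refl.
- by apply/tree_match_LNode; split=> // i; apply: tree_match_abs.
Qed.

Hypothesis A_infinite : infinite_set (@setT A).

Lemma ltree_names t :
  exists s : seq A, forall c, c \notin s -> ltree_all (fun x => name_of x != c) t.
Proof.
elim/ltree_ind: t => x f ts /fin_all_exists[ss ssP].
exists (name_of x :: flatten (codom ss)) => c; rewrite inE negb_or eq_sym.
case/andP=> xc css; split=> // i; apply: ssP; apply: contra css => ci.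
by apply/flattenP; exists (ss i) => //; apply: codom_f.
Qed.

(** The arbitrary finite index type lets one fresh name serve a pair of trees or all children of two
    nodes at once. *)
Lemma fresh_for_ltrees (I : finType) (ts : I -> ltree (letter A) ar) (s : seq A) :
  exists2 c, c \notin s & forall i, ltree_all (fun x => name_of x != c) (ts i).
Proof.
have [ss ssP] := fin_all_exists (fun i => ltree_names (ts i)).
have [c] := exists_notin (s ++ flatten (codom ss)) A_infinite.
rewrite mem_cat negb_or => /andP[cs css]; exists c => // i.
apply: ssP; apply: contra css => ci.
by apply/flattenP; exists (ss i) => //; apply: codom_f.
Qed.

Lemma tree_alpha_rename a c f (ts : {ffun 'I_(ar f) -> ltree (letter A) ar}) :
  c != a -> (forall i, ltree_all (fun x => name_of x != c) (ts i)) ->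
  tree_alpha (LNode (Bar a) ts)
             (LNode (Bar c) [ffun i => ltree_map (swap_letter a c) (ts i)]).
Proof.
move=> ca ct; apply: TreeAlphaBar => i; rewrite ffunE; set t' := ltree_map _ _.
have [d] := fresh_for_ltrees (fun b : bool => if b then ts i else t') [:: a; c].
rewrite !inE negb_or => /andP[da dc] dts.
exists d; split=> //; [exact: (dts true) | exact: (dts false) |].
rewrite /t' ltree_map_comp.
(* The two swaps compose to one only away from both [c] and [d]. *)
suff fresh : ltree_all (fun x => name_of x != c /\ name_of x != d) (ts i).
  by apply: eq_in_ltree_map fresh => x [xc xd] /=; rewrite swap_letter_comp.
move: (ct i) (dts true); elim/ltree_ind: (ts i) => x g us IHu [xc cu] [xd du].
by split=> // j; apply: IHu (cu j) (du j).
Qed.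

(* The induction carries a renaming [h] because the subtrees get renamed to a
   common fresh name before the induction hypothesis is used. *)
Lemma tree_match_alpha t u : tree_match eq t u -> tree_alpha t u.
Proof.
suff IH (h : letter A -> letter A) : tree_match eq (ltree_map h t) u ->
    tree_alpha (ltree_map h t) u.
  have tE : ltree_map id t = t.
    elim/ltree_ind: t {IH} => x f ts IHt /=; congr (LNode _ _).
    by apply/ffunP => i; rewrite ffunE.
  by rewrite -tE; apply: IH.
elim/ltree_ind: t h u => x f ts IHt h u /tree_match_LNodel[y [us [->]]] /=.
case: (h x) y => [a|a] [b|b] //=.
  move=> -> tsus; apply: TreeAlphaCongr => i; have := tsus i.
  by rewrite ffunE; apply: IHt.
move=> _ tsus; set hts := [ffun i => _].
(* A single [c] must be fresh for all children on both sides, because it becomes the common root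
   binder. *)
have [c] := fresh_for_ltrees
  (fun i : 'I_(ar f) + 'I_(ar f) => match i with inl i => hts i | inr i => us i end)
  [:: a; b].
rewrite !inE negb_or => /andP[ca cb] cts.
have ct i : ltree_all (fun x => name_of x != c) (hts i) := cts (inl i).
have cu i : ltree_all (fun x => name_of x != c) (us i) := cts (inr i).
apply: TreeAlphaTrans (tree_alpha_rename ca ct) _.
apply: TreeAlphaTrans _ (TreeAlphaSym (tree_alpha_rename cb cu)).
(* The swap is absorbed into the renaming over which the induction hypothesis is quantified. *)
apply: TreeAlphaCongr => i; rewrite !ffunE ltree_map_comp; apply: IHt.
rewrite -ltree_map_comp.
have tt : tree_match (swap_graph a c) (hts i) (ltree_map (swap_letter a c) (hts i)).
  exact: tree_match_swap.
have uu : tree_match (swap_graph b c) (us i) (ltree_map (swap_letter b c) (us i)).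
  exact: tree_match_swap.
have := tree_match_comp (tree_match_inv tt) (tree_match_comp (tsus i) uu).
by rewrite ffunE; apply: tree_match_mono; apply: swap_graph_unabs.
Qed.

Lemma tree_alphaP t u : tree_alpha t u <-> tree_match eq t u.
Proof. by split; [apply: tree_alpha_match | apply: tree_match_alpha]. Qed.

End TreeScan.

(** * The product automaton on trees *)

Section TreeAutomata.
Variables (A : countType) (Sig : finType) (ar : Sig -> nat).
Variables (A0 : {fset letter A}) (N : nfta (@label_ar A0 Sig ar)).
Hypothesis A_infinite : infinite_set (@setT A).

Lemma tree_match_restrict (R : A -> A -> Prop) (t u : ltree A0 ar) :
  tree_match (extend_rel (restrict_rel A0 R)) (ltree_map val t) (ltree_map val u) <->
  tree_match R (ltree_map val t) (ltree_map val u).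
Proof.
have inA (s : ltree A0 ar) : ltree_all (fun x => x \in A0) (ltree_map val s).
  by apply: ltree_all_map => x; apply: valP.
split; apply: tree_match_sub (inA t) (inA u).
  exact: extend_restrict_sub.
exact: sub_extend_restrict.
Qed.

(* Working bottom-up, the automaton guesses the relation that holds at each node
   and checks at its parent that the guess is the one obtained by rebinding. *)
Definition alpha_nfta : nfta (@label_ar A0 Sig ar) :=
  @Nfta (A0 * Sig)%type (@label_ar A0 Sig ar) (nfta_state N * {set A0 * A0})%type
    [set p | (p.1 \in nfta_final N) && (p.2 == restrict_rel A0 eq)]
    (fun yf qs => [set p | [exists x : A0,
       [&& `[< letter_match (extend_rel p.2) (val x) (val yf.1) >],
           [forall i, (qs i).2 == rebind_restrict p.2 x yf.1]
         & p.1 \in @nfta_trans _ _ N (x, yf.2) [ffun i => (qs i).1]]]]).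

Lemma alpha_nfta_reach q (S : {set A0 * A0}) (u : ltree A0 ar) :
  @nfta_reach _ _ alpha_nfta u (q, S) <->
  exists2 t : ltree A0 ar, nfta_reach t q &
    tree_match (extend_rel S) (ltree_map val t) (ltree_map val u).
Proof.
elim/ltree_ind: u q S => y f us IHu q S; split.
  case=> qs usqs; rewrite inE => /existsP[x /and3P[/asboolP xy /forallP qsS qx]].
  have /fin_all_exists2[ts tsqs tsus] : forall i, exists2 t : ltree A0 ar,
      nfta_reach t (qs i).1 &
      tree_match (rebind (extend_rel S) (val x) (val y))
        (ltree_map val t) (ltree_map val (us i)).
    move=> i; have := usqs i; rewrite [qs i]surjective_pairing (eqP (qsS i)).
    by case/IHu=> t tq /tree_match_restrict tu; exists t.
  exists (LNode (f := f) x [ffun i => ts i]).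
    by exists [ffun i => (qs i).1] => // i; rewrite !ffunE.
  by apply/tree_match_LNode; split=> // i; rewrite !ffunE.
(* Induction serves only as case analysis here, to expose the root letter and symbol. *)
case=> t; elim/ltree_ind: t => x g ts _ [qs tsqs qx] tu.
have [/= xy [e _]] := tu; subst g.
have {tu}/tree_match_LNode[_ tsus] := tu.
(* All children carry the same guess, the one that the parent will check. *)
exists [ffun i => (qs i, rebind_restrict S x y)].
  move=> i; rewrite ffunE; apply/IHu; exists (ts i); first exact: tsqs.
  by apply/tree_match_restrict; have := tsus i; rewrite !ffunE.
rewrite inE; apply/existsP; exists x; apply/and3P; split; first exact/asboolP.
  by apply/forallP => i; rewrite ffunE.
by rewrite (_ : [ffun i => _] = qs) //; apply/ffunP => i; rewrite !ffunE.
Qed.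

(** The final states demand equality at the root; from there the checks at each parent determine all
    guesses further down. *)
Lemma tree_restrict_regular :
  tree_regular A0 (tree_restrict A0
    (closure_under (@tree_alpha A Sig ar) (tree_literal N))).
Proof.
exists alpha_nfta; apply/seteqP; split=> u.
  case=> -[_ [t [q qF tq] <-]] /(tree_alphaP A_infinite) tu /ltree_all_val[u0 ue].
  exists u0 => //; exists (q, restrict_rel A0 eq); first by rewrite inE /= qF eqxx.
  by apply/alpha_nfta_reach; exists t => //; apply/tree_match_restrict; rewrite -ue.
case=> u0 [[q S]]; rewrite inE /= => /andP[qF /eqP ->].
move=> /alpha_nfta_reach[t tq /tree_match_restrict tu] <-; split.
  by exists (ltree_map val t); [exists t => //; exists q | apply/tree_alphaP].
by apply: ltree_all_map => x; apply: valP.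
Qed.

End TreeAutomata.

Theorem corollary3p17 (A : countType) (A_infinite : infinite_set (@setT A))
    (A0 : {fset letter A}) :
  (forall L : set (seq (letter A)),
     closed_under (@word_alpha A) L ->
     (exists N : nfa A0, L = closure_under (@word_alpha A) (word_literal N)) ->
     word_regular A0 (word_restrict A0 L)) /\
  (forall L : set (nat -> letter A),
     closed_under (@omega_alpha A) L ->
     (exists N : nfa A0, L = closure_under (@omega_alpha A) (omega_literal N)) ->
     omega_regular A0 (omega_restrict A0 L)) /\
  (forall (Sig : finType) (ar : Sig -> nat) (L : set (ltree (letter A) ar)),
     closed_under (@tree_alpha A Sig ar) L ->
     (exists N : nfta (@label_ar A0 Sig ar),
        L = closure_under (@tree_alpha A Sig ar) (tree_literal N)) ->
     tree_regular A0 (tree_restrict A0 L)).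
Proof.
split; [|split] => [L _ [N ->]|L _ [N ->]|Sig ar L _ [N ->]].
- exact: word_restrict_regular.
- exact: omega_restrict_regular.
- exact: tree_restrict_regular.
Qed.
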